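(* Suppose $v_1,\dots,v_N:\mathbb R\to\mathbb R$ are concave, increasing and differentiable. Then $\mathbf y\in\widetilde X^*(\overline\xi\,\mathbf 1)$; that is, $\mathbf y=(y_1,\dots,y_N)$ is a Nash equilibrium of the PT game at the price vector $\mathbf p=\overline\xi\,\mathbf 1$.
   Context: Setting. $N\ge 1$ players $i=1,\dots,N$ choose $x_i\in\mathcal X_i$, where $\mathcal X_i\subseteq\mathbb R$ is compact and convex; $\mathcal X=\prod_i\mathcal X_i$. Constants: targets $y_i\in\mathcal X_i$, $a_i>0$, $b_i\ge 0$. A price vector $\mathbf p=(p_1,\dots,p_N)\in\mathcal P\subseteq\mathbb R^N$ is fixed by a coordinator, with $\overline\xi\,\mathbf 1\in\mathcal P$; $\mathbf 1$ is the all-ones vector in $\mathbb R^N$. The random variable $\xi$ takes values in a finite set $\Xi=\{\xi_1,\dots,\xi_M\}\subset\mathbb R$ with probabilities $q=(q_1,\dots,q_M)$, mean $\overline\xi=\sum_k q_k\xi_k$, and positive variance. The outcome of player $i$ is $$J_i(x_i,\mathbf x_{-i},\mathbf p,\xi)=-a_i\Big(\tfrac1N\sum_{j=1}^N x_j-\tfrac1N\sum_{j=1}^N y_j\Big)^2+b_i-p_ix_i-(y_i-x_i)\xi .$$ PT game: the utilities are $\widetilde J_i(x_i,\mathbf x_{-i},\mathbf p)=\sum_{k=1}^M q_k\,v_i\big(J_i(x_i,\mathbf x_{-i},\mathbf p,\xi_k)\big)$. A point $\mathbf x^*\in\mathcal X$ is a Nash equilibrium of the PT game at $\mathbf p$ if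 $\widetilde J_i(x_i^*,\mathbf x_{-i}^*,\mathbf p)\ge\widetilde J_i(x_i,\mathbf x_{-i}^*,\mathbf p)$ for all $x_i\in\mathcal X_i$ and all $i=1,\dots,N$. The set of these is $\widetilde X^*(\mathbf p)$. *)

(* Defs.v *)
From HB Require Import structures.
From mathcomp Require Import all_boot all_order all_algebra.
From mathcomp Require Import all_classical all_reals all_analysis.

Set Implicit Arguments.
Unset Strict Implicit.
Unset Printing Implicit Defensive.

Import Order.TTheory GRing.Theory Num.Theory.
Import numFieldNormedType.Exports.

Local Open Scope classical_set_scope.
Local Open Scope ring_scope.

(* Joint actions, targets and price vectors are row vectors
   in 'rV[R]_N, and the random variable xi is given by its law: it takes the
   value xi k with probability q k, for k : 'I_M. *)

Definition concave_function (R : realType) (f : R -> R) : Prop :=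
  convex_function (E := R^o) [set: R^o] (fun t => - f t).

Definition prob_vector (R : realType) (M : nat) (q : 'I_M -> R) : Prop :=
  (forall k, 0 <= q k) /\ \sum_(k < M) q k = 1.

Definition mean (R : realType) (M : nat) (q xi : 'I_M -> R) : R :=
  \sum_(k < M) q k * xi k.

Definition variance_of (R : realType) (M : nat) (q xi : 'I_M -> R) : R :=
  \sum_(k < M) q k * (xi k - mean q xi) ^+ 2.

Definition joint_actions (R : realType) (N : nat) (X : 'I_N -> set R) :
    set 'rV[R]_N :=
  [set x | forall i, X i (x ord0 i)].

(* The profile (z, x_{-i}). *)
Definition deviate (R : realType) (N : nat) (x : 'rV[R]_N) (i : 'I_N) (z : R) :
    'rV[R]_N :=
  \row_(j < N) (if j == i then z else x ord0 j).

Definition outcome (R : realType) (N : nat) (a b : 'I_N -> R) (y : 'rV[R]_N)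
    (i : 'I_N) (x p : 'rV[R]_N) (s : R) : R :=
  - a i * (N%:R^-1 * (\sum_(j < N) x ord0 j)
           - N%:R^-1 * (\sum_(j < N) y ord0 j)) ^+ 2
  + b i - p ord0 i * x ord0 i - (y ord0 i - x ord0 i) * s.

Definition PT_utility (R : realType) (N M : nat) (a b : 'I_N -> R)
    (y : 'rV[R]_N) (q xi : 'I_M -> R) (v : 'I_N -> R -> R)
    (i : 'I_N) (x p : 'rV[R]_N) : R :=
  \sum_(k < M) q k * v i (outcome a b y i x p (xi k)).

Definition PT_nash (R : realType) (N M : nat) (X : 'I_N -> set R)
    (a b : 'I_N -> R) (y : 'rV[R]_N) (q xi : 'I_M -> R) (v : 'I_N -> R -> R)
    (p : 'rV[R]_N) : set 'rV[R]_N :=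
  [set x | joint_actions X x /\
    forall (i : 'I_N) (z : R), X i z ->
      PT_utility a b y q xi v i (deviate x i z) p
        <= PT_utility a b y q xi v i x p].

(* Main.v *)
(* At the uniform price equal to the mean of xi, playing the target y_i makes the
   outcome of player i the constant c = b_i - mean * y_i, while any deviation
   has expected outcome c - a_i (..)^2 <= c.  Jensen's inequality for the concave
   v_i followed by monotonicity then shows that no deviation improves on v_i c. *)

Require Import Defs.
From HB Require Import structures.
From mathcomp Require Import all_boot all_order all_algebra.
From mathcomp Require Import all_classical all_reals all_analysis.
From mathcomp Require Import ring lra.

Set Implicit Arguments.
Unset Strict Implicit.
Unset Printing Implicit Defensive.

Import Order.TTheory GRing.Theory Num.Theory.
Import numFieldNormedType.Exports.

Local Open Scope classical_set_scope.
Local Open Scope ring_scope.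

(** Two-point concavity at the convex weight [c / (c + d)], multiplied through by [c + d]; the
    weight [d] may vanish. *)
Lemma concave_function_weighted (R : realType) (f : R -> R) (c d s t : R) :
  concave_function f -> 0 < c -> 0 <= d ->
  c * f s + d * f t <= (c + d) * f ((c * s + d * t) / (c + d)).
Proof.
move=> cf c0 d0; have cd0 : 0 < c + d by rewrite ltr_wpDr.
have l0 : 0 <= c / (c + d) by rewrite divr_ge0 ?ltW.
have l1 : c / (c + d) <= 1 by rewrite ler_pdivrMr ?mul1r ?lerDl.
have onemE : 1 - c / (c + d) = d / (c + d) by field; rewrite gt_eqF.
have : - f (c / (c + d) * s + (1 - c / (c + d)) * t) <=
    c / (c + d) * - f s + (1 - c / (c + d)) * - f t.
  exact: (cf (Itv01 l0 l1) s t (in_setT _) (in_setT _)).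
rewrite onemE !mulrN -opprD lerN2.
have -> : c / (c + d) * s + d / (c + d) * t = (c * s + d * t) / (c + d).
  by field; rewrite gt_eqF.
have -> : c / (c + d) * f s + d / (c + d) * f t
    = (c * f s + d * f t) / (c + d) by field; rewrite gt_eqF.
by rewrite ler_pdivrMr// [leRHS]mulrC.
Qed.

(* The extra point s of positive weight c keeps the total weight positive along
   the induction, so that null weights need no separate treatment. *)
Lemma concave_function_sum (R : realType) (I : Type) (r : seq I) (f : R -> R)
    (q t : I -> R) (c s : R) :
  concave_function f -> (forall i, 0 <= q i) -> 0 < c ->
  c * f s + \sum_(i <- r) q i * f (t i) <=
  (c + \sum_(i <- r) q i) *
    f ((c * s + \sum_(i <- r) q i * t i) / (c + \sum_(i <- r) q i)).
Proof.
move=> cf q0; elim: r c s => [|i r IH] c s c0.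
  by rewrite !big_nil !addr0 mulrAC divff ?mul1r// gt_eqF.
rewrite !big_cons !addrA.
have cq0 : 0 < c + q i by rewrite ltr_wpDr.
(* Merge [s] and [t i] into their barycentre, of weight [c + q i]; it serves as the extra point for
   the tail. *)
have := IH (c + q i) ((c * s + q i * t i) / (c + q i)) cq0.
rewrite [(c + q i) * (_ / _)]mulrC divfK ?gt_eqF//.
by apply: le_trans; rewrite lerD2r concave_function_weighted.
Qed.

Lemma jensen_concave (R : realType) (M : nat) (q t : 'I_M -> R) (f : R -> R) :
  concave_function f -> prob_vector q ->
  \sum_(k < M) q k * f (t k) <= f (mean q t).
Proof.
move=> cf [q0 q1].
(* With the mean itself as extra point, of weight 1, the barycentre stays at the mean, and one copy
   of [f (mean q t)] cancels from each side. *)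
have := concave_function_sum (index_enum 'I_M) t (mean q t) cf q0 ltr01.
rewrite q1 -/(mean q t) !mul1r.
have -> : (mean q t + mean q t) / (1 + 1) = mean q t by field.
by rewrite mulrDl mul1r lerD2l.
Qed.

Lemma mean_affine (R : realType) (M : nat) (q t : 'I_M -> R) (A B : R) :
  prob_vector q -> mean q (fun k => A - B * t k) = A - B * mean q t.
Proof.
move=> [_ q1]; rewrite /mean mulr_sumr -[X in X - _]mul1r -q1 mulr_suml -sumrB.
by apply: eq_bigr => k _; ring.
Qed.

Theorem proposition6 (R : realType) (N M : nat) (hN : (0 < N)%N)
    (X : 'I_N -> set R)
    (hXcompact : forall i : 'I_N, compact (X i))
    (hXconvex : forall i : 'I_N, convex_set (M := R^o) (X i))
    (y : 'rV[R]_N) (hy : forall i : 'I_N, X i (y ord0 i))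
    (a b : 'I_N -> R)
    (ha : forall i : 'I_N, 0 < a i) (hb : forall i : 'I_N, 0 <= b i)
    (q xi : 'I_M -> R) (hxi : injective xi) (hq : prob_vector q)
    (hvar : 0 < variance_of q xi)
    (P : set 'rV[R]_N) (hP : P (const_mx (mean q xi)))
    (v : 'I_N -> R -> R)
    (hvconcave : forall i : 'I_N, concave_function (v i))
    (hvincr : forall i : 'I_N, {homo v i : s t / s <= t})
    (hvdiff : forall (i : 'I_N) (t : R), derivable (v i) t 1) :
  PT_nash X a b y q xi v (const_mx (mean q xi)) y.
Proof.
split=> // i z _; rewrite /PT_utility.
set m := mean q xi; set c := b i - m * y ord0 i.
have y_cst k : outcome a b y i y (const_mx m) (xi k) = c.
  by rewrite /outcome mxE /c; ring.
rewrite [leRHS](eq_bigr (fun k => q k * v i c)) => [|k _]; last by rewrite y_cst.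
rewrite -mulr_suml hq.2 mul1r.
apply: le_trans (jensen_concave _ (hvconcave i) hq) _; apply: hvincr.
(* The outcome is affine in the value of [xi], so averaging puts [m] in its place; then
   [- m * z - (y_i - z) * m] equals [- m * y_i], free of [z]. *)
rewrite /outcome mean_affine// !mxE eqxx -/m.
set u := _ ^+ 2; have u0 : 0 <= a i * u by rewrite mulr_ge0 ?sqr_ge0 ?ltW.
by rewrite /c; lra.
Qed.
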